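(* Let $G=(V,E)$ be a finite connected graph with $|V|=n$. Fix a vertex $a\in V$ and label the vertices $V=\{v_1,\dots,v_n\}$ with $v_1=a$ so that $\operatorname{dist}(a,v_i)\le\operatorname{dist}(a,v_j)$ whenever $i<j$. Let $A$ be the adjacency matrix and $D_G$ the diagonal degree matrix of $G$ (with respect to this labeling), so $\Delta_G=D_G-A$. For $\rho>1$ set $\Lambda_\rho=\operatorname{diag}(\rho,\rho^2,\dots,\rho^n)$ and $Q_\rho=\Lambda_\rho-D_G$. Then there exists $R=R(G)>0$ such that, for every $\rho>R$, the operator $H_{Q_\rho}=\Delta_G+Q_\rho=\Lambda_\rho-A$ satisfies Conditions $B_2$, (I) and (S).
   Context: $G$ is a finite simple undirected graph, $\operatorname{dist}$ is the graph distance, and $\Delta_G$ is the combinatorial Laplacian $\Delta_G u(j)=\sum_{k\sim j}(u(j)-u(k))$. For a real symmetric $n\times n$ matrix $H$ with real orthonormal eigenbasis $(\phi_k)_{k=1}^n$ and $H\phi_k=\lambda_k\phi_k$: Condition $B_2$: $\lambda_j+\lambda_k=\lambda_{j'}+\lambda_{k'}$ if and only if $\{j,k\}=\{j',k'\}$ (in particular the eigenvalues are simple). Condition (I): the matrix $(\phi_k(j)^2)_{j,k=1}^n$ is invertible. Condition (S): for every pair $k\neq\ell$ there is a coordinate $j$ with $\phi_k(j)\phi_\ell(j)\neq0$. *)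

(* Defs.v *)
From mathcomp Require Import all_boot all_order all_algebra.
From mathcomp Require Import reals.

Set Implicit Arguments.
Unset Strict Implicit.
Unset Printing Implicit Defensive.

Import Order.TTheory GRing.Theory Num.Theory.
Local Open Scope ring_scope.

Definition simple_graph (V : finType) (e : rel V) : Prop :=
  symmetric e /\ irreflexive e.

Definition connected_graph (V : finType) (e : rel V) : Prop :=
  forall x y : V, connect e x y.

(* The least length of a walk from x to y. A shortest walk repeats no vertex,
   so its length is < #|V|; the value is #|V| when y is not reachable from x. *)
Definition gdist (V : finType) (e : rel V) (x y : V) : nat :=
  find (fun m => [exists p : m.-tuple V, path e x p && (last x p == y)])
       (iota 0 #|V|).

(* In what follows v : 'I_n -> V is a labeling of the vertices; the 1-based
   v_i of the mathematical text is the value of v at the ordinal i - 1. *)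

Definition adjacency_mx (R : realType) (V : finType) (e : rel V) (n : nat)
    (v : 'I_n -> V) : 'M[R]_n :=
  \matrix_(i, j) (e (v i) (v j))%:R.

Definition degree_mx (R : realType) (V : finType) (e : rel V) (n : nat)
    (v : 'I_n -> V) : 'M[R]_n :=
  diag_mx (\row_i #|[set y | e (v i) y]|%:R).

Definition laplacian_mx (R : realType) (V : finType) (e : rel V) (n : nat)
    (v : 'I_n -> V) : 'M[R]_n :=
  degree_mx R e v - adjacency_mx R e v.

Definition Lambda_mx (R : realType) (n : nat) (rho : R) : 'M[R]_n :=
  diag_mx (\row_i rho ^+ i.+1).

Definition potential_mx (R : realType) (V : finType) (e : rel V) (n : nat)
    (v : 'I_n -> V) (rho : R) : 'M[R]_n :=
  Lambda_mx n rho - degree_mx R e v.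

Definition hamiltonian (R : realType) (V : finType) (e : rel V) (n : nat)
    (v : 'I_n -> V) (rho : R) : 'M[R]_n :=
  laplacian_mx R e v + potential_mx e v rho.

Lemma laplacian_mxE (R : realType) (V : finType) (e : rel V) (n : nat)
    (v : 'I_n -> V) (u : 'cV[R]_n) (j : 'I_n) : bijective v ->
  (laplacian_mx R e v *m u) j 0
    = \sum_(k | e (v j) (v k)) (u j 0 - u k 0).
Proof.
move=> bij_v; rewrite sumrB mulmxBl !mxE; congr (_ - _).
  under eq_bigr do rewrite !mxE.
  rewrite (bigD1 j) //= eqxx mulr1n big1 ?addr0; last first.
    by move=> i /negPf ij; rewrite eq_sym ij mulr0n mul0r.
  rewrite sumr_const mulr_natl -(on_card_preimset (f := v)); last first.
    exact: onW_bij.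
  by congr (_ *+ _); apply: eq_card => k; rewrite !inE.
rewrite [RHS]big_mkcond /=; apply: eq_bigr => k _; rewrite mxE.
by case: (e _ _); rewrite ?mul1r ?mul0r.
Qed.

Lemma hamiltonianE (R : realType) (V : finType) (e : rel V) (n : nat)
    (v : 'I_n -> V) (rho : R) :
  hamiltonian e v rho = Lambda_mx n rho - adjacency_mx R e v.
Proof. by rewrite /hamiltonian /potential_mx addrC subrKA. Qed.

(* n orthonormal vectors of R^n form a basis, so spanning is not required. *)
Definition orthonormal_eigenbasis (R : realType) (n : nat) (H : 'M[R]_n)
    (lam : 'I_n -> R) (phi : 'I_n -> 'cV[R]_n) : Prop :=
  (forall k l : 'I_n, \sum_j phi k j 0 * phi l j 0 = (k == l)%:R) /\
  (forall k : 'I_n, H *m phi k = lam k *: phi k).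

Definition condition_B2 (R : realType) (n : nat) (lam : 'I_n -> R) : Prop :=
  forall j k j' k' : 'I_n,
    lam j + lam k = lam j' + lam k' <-> [set j; k] = [set j'; k'].

Definition condition_I (R : realType) (n : nat)
    (phi : 'I_n -> 'cV[R]_n) : Prop :=
  \matrix_(j < n, k < n) (phi k j 0) ^+ 2 \in unitmx.

Definition condition_S (R : realType) (n : nat)
    (phi : 'I_n -> 'cV[R]_n) : Prop :=
  forall k l : 'I_n, k != l -> exists j : 'I_n, phi k j 0 * phi l j 0 != 0.

(* The conditions refer to an orthonormal eigenbasis of H. They are required of
   all of them; the first conjunct rules out vacuous truth. *)
Definition satisfies_B2_I_S (R : realType) (n : nat) (H : 'M[R]_n) : Prop :=
  (exists (lam : 'I_n -> R) (phi : 'I_n -> 'cV[R]_n),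
      orthonormal_eigenbasis H lam phi) /\
  (forall (lam : 'I_n -> R) (phi : 'I_n -> 'cV[R]_n),
      orthonormal_eigenbasis H lam phi ->
      [/\ condition_B2 lam, condition_I phi & condition_S phi]).

(* Main.v *)
Require Import Defs.
From mathcomp Require Import all_boot all_order all_algebra.
From mathcomp Require Import reals complex.
From mathcomp Require Import ring lra.

(* Let x be an eigenvector of Lambda_rho - A for lam, let c be an index where
   |x| is maximal (a peak) and q = rho^(c+1). The c-th equation gives
   |lam - q| <= n, so every other rho^(i+1) is at distance at least q/2 from
   lam, and each step away from c shrinks x by a factor 2n/q. In particular
   x_c^2 carries more than half of the squared norm: hence the peaks of an
   orthonormal eigenbasis are a permutation of the indices, the matrix of
   squared entries is diagonally dominant up to this permutation (Condition
   (I)), and Condition B_2 follows from the lacunarity of the powers of rho.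
   For (S) every eigenvector is nonzero at the root a: on a geodesic from v_c
   to a the labels are smaller than c, so lam - rho^(i+1) is positive and at
   most 2q, and by induction on the distance t to v_c, (-1)^t x_i / x_c is at
   least (4q)^-t. An orthonormal eigenbasis exists because a real symmetric
   matrix is diagonalizable over the reals and the eigenvalues are simple. *)

Set Implicit Arguments.
Unset Strict Implicit.
Unset Printing Implicit Defensive.

Import Order.TTheory GRing.Theory Num.Theory.
Local Open Scope ring_scope.

(** * Walks and the graph distance *)

Section GraphDistance.
Variables (V : finType) (e : rel V).
Implicit Types (x y z : V) (p : seq V).

Lemma gdist_leq_card x y : (gdist e x y <= #|V|)%N.
Proof. by rewrite -[leqRHS](size_iota 0) find_size. Qed.

(** If p has at least [#|V|] edges, the cap on [gdist] suffices; otherwise [size p] occurs in the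
    searched list and [find] stops there at the latest. *)
Lemma gdist_leq_size x p : path e x p -> (gdist e x (last x p) <= size p)%N.
Proof.
move=> xp; rewrite leqNgt; apply/negP => lt_p.
have ltV : (size p < #|V|)%N := leq_trans lt_p (gdist_leq_card _ _).
have := before_find 0%N lt_p; rewrite nth_iota // add0n => /existsP[].
by exists (in_tuple p); rewrite xp eqxx.
Qed.

Lemma gdist_path x y : connect e x y ->
  exists p, [/\ path e x p, last x p = y & size p = gdist e x y].
Proof.
move=> /connectP[p0 xp0 ->]; case/shortenP: xp0 => p xp up _.
have ltp : (size p < #|V|)%N.
  by rewrite -[_.+1]/(size (x :: p)) -(card_uniqP up) max_card.
have hasP : has (fun m => [exists q : m.-tuple V,
    path e x q && (last x q == last x p)]) (iota 0 #|V|).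
  apply/hasP; exists (size p); first by rewrite mem_iota.
  by apply/existsP; exists (in_tuple p); rewrite xp eqxx.
have := nth_find 0%N hasP; rewrite nth_iota; last first.
  by rewrite has_find size_iota in hasP.
rewrite add0n => /existsP[q /andP[xq /eqP lq]].
by exists q; rewrite size_tuple.
Qed.

Hypotheses (e_sym : symmetric e) (e_conn : connected_graph e).

Lemma gdistxx x : gdist e x x = 0%N.
Proof. by apply/eqP; rewrite -leqn0 (gdist_leq_size (p := [::])). Qed.

Lemma gdist_eq0 x y : gdist e x y = 0%N -> x = y.
Proof.
by have [[|z p] [_ /= <- <-]] := gdist_path (e_conn x y).
Qed.

Lemma gdist_triangle x y z : (gdist e x z <= gdist e x y + gdist e y z)%N.
Proof.
have [p [xp lp <-]] := gdist_path (e_conn x y).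
have [q [yq lq <-]] := gdist_path (e_conn y z).
by rewrite -size_cat -lq -lp -last_cat gdist_leq_size // cat_path xp lp.
Qed.

Lemma gdist_sym x y : gdist e x y = gdist e y x.
Proof.
wlog suff le_xy : x y / (gdist e x y <= gdist e y x)%N.
  by apply/eqP; rewrite eqn_leq !le_xy.
have [p [yp lp <-]] := gdist_path (e_conn y x).
have := gdist_leq_size (x := x) (p := rev (belast y p)).
rewrite size_rev size_belast => le_p.
have -> : y = last x (rev (belast y p)).
  by case: (p) lp => [<-|z q _] //=; rewrite rev_cons last_rcons.
by apply: le_p; rewrite -lp rev_path (eq_path (e' := e)) // => u w; rewrite e_sym.
Qed.

Lemma gdist_edge y z x : e y z -> (gdist e x z <= (gdist e x y).+1)%N.
Proof.
move=> eyz; apply: leq_trans (gdist_triangle x y z) _.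
by rewrite -addn1 leq_add2l (gdist_leq_size (p := [:: z])) //= eyz.
Qed.

Lemma gdist_pred x z : (0 < gdist e x z)%N ->
  exists2 y, e y z & gdist e x z = (gdist e x y).+1.
Proof.
have [p [xp lp sp]] := gdist_path (e_conn x z).
case/lastP: p xp lp sp => [_ _ <- //|p w].
rewrite rcons_path last_rcons size_rcons => /andP[xp pw] wz sp _.
rewrite {w}wz in pw; exists (last x p) => //; apply/eqP.
by rewrite eqn_leq gdist_edge // -sp ltnS gdist_leq_size.
Qed.

End GraphDistance.

(** * Localization of an eigenvector around its peak *)

Section Localization.
Variables (R : realFieldType) (n : nat) (rho : R).
(** The n-th power serves [peak_nonvanishing], which uses 2n (8n)^t <= rho for distances t <= n; the
    other estimates rest on 16 n^2 <= rho. *)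
Hypothesis (rho_large : 2 * n%:R * (8 * n%:R) ^+ n <= rho).

Lemma nonempty_ge1 (c : 'I_n) : 1 <= n%:R :> R.
Proof. by rewrite ler1n (leq_ltn_trans _ (ltn_ord c)). Qed.

Lemma rho_large_le (c : 'I_n) t :
  (t <= n)%N -> 2 * n%:R * (8 * n%:R) ^+ t <= rho.
Proof.
move=> tn; apply: le_trans rho_large; rewrite ler_wpM2l ?mulr_ge0 ?ler0n //.
by rewrite ler_weXn2l //; have := nonempty_ge1 c; lra.
Qed.

Lemma rho_large_sqr (c : 'I_n) : 16 * n%:R ^+ 2 <= rho.
Proof.
have := rho_large_le c (t := 1) (leq_ltn_trans (leq0n c) (ltn_ord c)).
by apply: le_trans; rewrite expr1; lra.
Qed.

Lemma rho_large_lin (c : 'I_n) : 16 <= rho /\ 16 * n%:R <= rho.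
Proof.
by have := nonempty_ge1 c; have := rho_large_sqr c; split; nra.
Qed.

Lemma rho_gt1 (c : 'I_n) : 1 < rho.
Proof. by have [] := rho_large_lin c; lra. Qed.

Lemma rho_le_pow (c : 'I_n) (i : nat) : rho <= rho ^+ i.+1.
Proof. by rewrite ler_eXnr // ltW // (rho_gt1 c). Qed.

Lemma pow_lacunary (c : 'I_n) i j :
  (i < j)%N -> rho * rho ^+ i.+1 <= rho ^+ j.+1.
Proof. by move=> ij; rewrite -exprS ler_weXn2l // ltW // (rho_gt1 c). Qed.

(* (Lambda_rho - A) x = lam x for A the adjacency matrix of E, with the
   diagonal moved to the left-hand side. *)
Definition eigvec (E : rel 'I_n) (lam : R) (x : 'I_n -> R) :=
  forall i : 'I_n, (rho ^+ i.+1 - lam) * x i = \sum_(j | E i j) x j.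

Definition peak (x : 'I_n -> R) (c : 'I_n) :=
  x c != 0 /\ forall i, `|x i| <= `|x c|.

Lemma peak_exists (x : 'I_n -> R) i : x i != 0 -> exists c, peak x c.
Proof.
move=> xi0; case: (@arg_maxP _ R _ i xpredT (fun j => `|x j|)) => // c _ max_c.
exists c; split=> [|j]; last exact: max_c.
by rewrite -normr_gt0 (lt_le_trans _ (max_c i _)) ?normr_gt0.
Qed.

Lemma ler_sum_ord (P : pred 'I_n) (x : 'I_n -> R) B : 0 <= B ->
  (forall j, P j -> x j <= B) -> \sum_(j | P j) x j <= n%:R * B.
Proof.
move=> B0 xB; apply: le_trans (ler_sum _ xB) _.
rewrite sumr_const -[leLHS]mulr_natl.
by rewrite ler_wpM2r // ler_nat -[leqRHS]card_ord max_card.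
Qed.

Lemma ler_norm_sum_ord (P : pred 'I_n) (x : 'I_n -> R) B : 0 <= B ->
  (forall j, P j -> `|x j| <= B) -> `|\sum_(j | P j) x j| <= n%:R * B.
Proof. by move=> B0 xB; rewrite (le_trans (ler_norm_sum _ _ _)) ?ler_sum_ord. Qed.

Variables (E : rel 'I_n) (lam : R) (x : 'I_n -> R) (c : 'I_n).
Hypotheses (eig_x : eigvec E lam x) (peak_x : peak x c).
Let q := rho ^+ c.+1.

Lemma peak_eigenvalue : `|q - lam| <= n%:R.
Proof.
have [xc0 max_c] := peak_x; have xc_gt0 : 0 < `|x c| by rewrite normr_gt0.
rewrite -(ler_pM2r xc_gt0) -normrM eig_x.
by apply: ler_norm_sum_ord => [|j _]; rewrite ?max_c.
Qed.

(** [lam] is within n <= q/16 of q, while the other powers of rho are at most q/16 or at least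
    16q. *)
Lemma peak_gap i : i != c -> q <= 2 * `|rho ^+ i.+1 - lam|.
Proof.
rewrite neq_ltn => ic.
have := peak_eigenvalue; rewrite ler_norml => /andP[q1 q2].
have n1 := nonempty_ge1 c; have [r16 rn] := rho_large_lin c.
have rq := rho_le_pow c c; rewrite -/q in rq.
have := ler_norm (rho ^+ i.+1 - lam).
have := ler_norm (- (rho ^+ i.+1 - lam)).
rewrite normrN => a1 a2; case/orP: ic => /(pow_lacunary c); rewrite -/q => lac.
  have : 16 * rho ^+ i.+1 <= rho * rho ^+ i.+1.
    by rewrite ler_wpM2r // (le_trans _ (rho_le_pow c i)) //; lra.
  lra.
have : 16 * q <= rho * q by rewrite ler_wpM2r //; lra.
lra.
Qed.

Lemma peak_pow_gt0 : 0 < q.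
Proof. by rewrite exprn_gt0 // (lt_trans ltr01 (rho_gt1 c)). Qed.

(** Two choices of d occur: the indicator of i != c in [peak_sqr], and the distance from c in
    [peak_nonvanishing]. *)
Lemma decay (d : 'I_n -> nat) : d c = 0%N ->
  (forall i j, E i j -> (d i <= (d j).+1)%N) ->
  forall i, `|x i| <= (2 * n%:R / q) ^+ d i * `|x c|.
Proof.
move=> dc dE i; have [xc0 max_c] := peak_x.
have q0 := peak_pow_gt0.
have e0 : 0 <= 2 * n%:R / q by rewrite divr_ge0 ?mulr_ge0 ?ler0n ?ltW.
(* The exponent becomes any t <= d i, since a neighbour j of i is only known to satisfy d j >= d i -
   1. *)
have: (d i <= d i)%N by []; move: {1 3}(d i) => t.
elim: t i => [|t IHt] i ti; first by rewrite expr0 mul1r.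
have ic : i != c by apply: contraTneq ti => ->; rewrite dc.
have B0 : 0 <= (2 * n%:R / q) ^+ t * `|x c| by rewrite mulr_ge0 ?exprn_ge0.
have nbr_le j : E i j -> `|x j| <= (2 * n%:R / q) ^+ t * `|x c|.
  by move=> Eij; apply: IHt; rewrite -ltnS (leq_trans ti) ?dE.
have := ler_norm_sum_ord B0 nbr_le; rewrite -eig_x normrM => le1.
rewrite exprS -mulrA mulrAC ler_pdivlMr //.
have := peak_gap ic; have := normr_ge0 (x i); nra.
Qed.

(** By [decay], the entries off the peak contribute at most n (2n/q)^2 x_c^2, and 16 n^3 <= n rho <=
    q^2 makes this less than x_c^2. *)
Lemma peak_sqr : \sum_i x i ^+ 2 < 2 * x c ^+ 2.
Proof.
have [xc0 _] := peak_x; have q0 := peak_pow_gt0.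
have n1 := nonempty_ge1 c; have [r16 rn] := rho_large_lin c.
have rq : rho <= q := rho_le_pow c c.
have x0 : 0 < x c ^+ 2 by rewrite exprn_even_gt0.
have B0 : 0 <= (2 * n%:R / q * `|x c|) ^+ 2 by rewrite sqr_ge0.
rewrite (bigD1 c) //= mulr_natl mulr2n ltrD2l.
apply: (le_lt_trans (ler_sum_ord B0 _)) => [j jc|].
  have := @decay (fun i => i != c); rewrite eqxx => /(_ erefl) dec.
  have {dec} := dec (fun i j _ => leq_trans (leq_b1 _) (ltn0Sn _)) j.
  rewrite jc expr1 => xj; rewrite -[x j ^+ 2]ger0_norm ?sqr_ge0 // normrX.
  by rewrite lerXn2r ?nnegrE // (le_trans _ xj).
rewrite exprMn real_normK ?num_real // mulrA gtr_pMl // expr_div_n mulrA.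
rewrite ltr_pdivrMr ?(exprn_gt0 _ q0) // mul1r.
have rs := rho_large_sqr c.
have : n%:R * (16 * n%:R ^+ 2) <= n%:R * rho :> R by rewrite ler_wpM2l.
have : n%:R * rho <= q * q by rewrite ler_pM //; lra.
have : 0 < q * q by rewrite mulr_gt0.
lra.
Qed.

(* d is the distance from c and h the distance from the root; the conclusion
   concerns the vertices on the geodesics between the two. *)
Lemma peak_nonvanishing (d h : 'I_n -> nat) : d c = 0%N ->
  (forall i, d i = 0%N -> i = c) ->
  (forall i j, E i j -> (d i <= (d j).+1)%N) ->
  (forall i, (d i <= n)%N) ->
  (forall i, (0 < d i)%N -> exists2 j, E i j & d i = (d j).+1) ->
  (forall i j, E i j -> (h j <= (h i).+1)%N) ->
  (forall i, (h i < h c)%N -> (i < c)%N) ->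
  (forall i, (h c <= h i + d i)%N) ->
  forall i, (h i + d i = h c)%N -> x i != 0.
Proof.
move=> dc d0 dE dn dpred hE hc hd.
have [xc0 _] := peak_x; have q0 := peak_pow_gt0.
have n1 := nonempty_ge1 c; have [r16 rn] := rho_large_lin c.
have rq : rho <= q := rho_le_pow c c.
(* In 4q, a factor 2q pays for the division by lam - rho^(i+1), and a factor 2 for the half of the
   leading term lost to the remaining neighbours. *)
pose X j := x j / x c; pose w := (4 * q)^-1.
have w0 : 0 < w by rewrite invr_gt0 mulr_gt0.
have qw : q * w = 4^-1 by rewrite /w; field; rewrite gt_eqF.
have Xdec j t : (t <= d j)%N -> `|X j| <= (8 * n%:R * w) ^+ t.
  move=> tj; rewrite normrM normfV ler_pdivrMr ?normr_gt0 //.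
  apply: le_trans (decay dc dE j) _; rewrite ler_wpM2r //.
  have -> : 8 * n%:R * w = 2 * n%:R / q by rewrite /w; field; rewrite gt_eqF.
  rewrite ler_wiXn2l ?divr_ge0 ?mulr_ge0 ?ler0n ?ltW //.
  by rewrite ltr_pdivrMr // mul1r; lra.
clearbody w.
(* On the geodesics towards the root all the terms of leading order have the
   sign (-1)^t, hence they cannot cancel. *)
suff key t i : d i = t -> (h i + t = h c)%N -> w ^+ t <= (-1) ^+ t * X i.
  move=> i hi; apply: contraTneq (key _ i erefl hi) => xi0.
  by rewrite /X xi0 mul0r mulr0 -ltNge exprn_gt0.
elim: t i => [|t IHt] i di hi.
  by rewrite (d0 _ di) /X divff // !expr0 mulr1.
have ic : (i < c)%N by apply: hc; rewrite -hi addnS ltnS leq_addr.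
have d_gt0 : (0 < d i)%N by rewrite di.
have [j0 Eij0 dj0] := dpred i d_gt0.
(* Such a j is again on a geodesic: h grows by at most one from i to j, and [hd] gives the reverse
   bound. *)
have IHj j : E i j -> d j = t -> w ^+ t <= (-1) ^+ t * X j.
  move=> Eij dj; apply: IHt => //; apply/eqP.
  rewrite eqn_leq; apply/andP; split; last by rewrite -dj hd.
  by rewrite -hi -addSnnS leq_add2r hE.
have wt0 : 0 < w ^+ t by rewrite exprn_gt0.
have eqX : (lam - rho ^+ i.+1) * ((-1) ^+ t.+1 * X i)
    = (-1) ^+ t * X j0 + \sum_(j | E i j && (j != j0)) (-1) ^+ t * X j.
  transitivity (\sum_(j | E i j) (-1) ^+ t * X j); last by rewrite (bigD1 j0).
  by rewrite -mulr_sumr /X -mulr_suml -eig_x [(-1) ^+ _]exprS; ring.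
have B0 : 0 <= (8 * n%:R * w) ^+ t.+1.
  by rewrite exprn_ge0 ?mulr_ge0 ?ler0n ?ltW.
(* Terms with d j = t are nonnegative by induction; the other neighbours have d j > t and are small
   by [Xdec]. *)
have sum_ge : - (n%:R * (8 * n%:R * w) ^+ t.+1)
    <= \sum_(j | E i j && (j != j0)) (-1) ^+ t * X j.
  rewrite lerNl -sumrN; apply: ler_sum_ord => // j /andP[Eij _].
  have [djt|djt] := eqVneq (d j) t.
    by apply: le_trans B0; rewrite oppr_le0 (le_trans (ltW wt0)) ?IHj.
  rewrite (le_trans (ler_norm _)) // normrN normrM normrX normrN1 expr1n mul1r.
  by apply: Xdec; rewrite ltn_neqAle eq_sym djt -ltnS -di dE.
have small : n%:R * (8 * n%:R * w) ^+ t.+1 <= w ^+ t / 2.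
  have := rho_large_le c (t := t.+1); rewrite -di dn di => /(_ isT) le_rho.
  rewrite exprMn exprS [w ^+ t.+1]exprS.
  move: le_rho; rewrite exprS; set z := _ * _ ^+ t => le_rho.
  have : 0 <= w * w ^+ t by rewrite mulr_ge0 ?ltW.
  nra.
have [dj0t] : (d j0).+1 = t.+1 by rewrite -dj0.
have lower := IHj _ Eij0 dj0t.
have [q1 q2] : q - lam <= n%:R /\ lam - q <= n%:R.
  by have := peak_eigenvalue; rewrite ler_norml; lra.
have lac := pow_lacunary c ic; rewrite -/q in lac.
have ri := rho_le_pow c i.
have a0 : 0 < lam - rho ^+ i.+1 by nra.
have a1 : lam - rho ^+ i.+1 <= 2 * q by nra.
rewrite -(ler_pM2l a0) eqX (exprS w t).
apply: (@le_trans _ _ (w ^+ t / 2)).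
  apply: (@le_trans _ _ (2 * q * (w * w ^+ t))).
    by rewrite ler_wpM2r // mulr_ge0 ?ltW.
  have -> : 2 * q * (w * w ^+ t) = 2 * (q * w) * w ^+ t by ring.
  by rewrite qw; lra.
have := lerD lower (le_trans (_ : - (w ^+ t / 2) <= _) sum_ge).
rewrite lerN2 => /(_ small).
by apply: le_trans; lra.
Qed.

End Localization.

(** * Diagonalization of real symmetric matrices *)

(** Over [R[i]], A is Hermitian, hence similar to a real diagonal matrix; real matrices similar over
    [R[i]] are similar through a real matrix, which is then read back in R. *)
Lemma sym_diagonalizable (R : rcfType) n (A : 'M[R]_n) : A^T = A ->
  exists (d : 'rV[R]_n) (S : 'M[R]_n), S \in unitmx /\ S *m A = diag_mx d *m S.
Proof.
move=> A_sym; pose toC := real_complex R; pose AC := map_mx toC A.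
have AC_real : AC \is a mxOver Num.real.
  by apply/mxOverP => i j; rewrite mxE complex_real.
have AC_herm : AC \is hermsymmx.
  apply: realsym_hermsym => //; apply/is_hermitianmxP.
  by rewrite expr0 scale1r map_mx_id // /AC map_trmx A_sym.
have d_real := hermitian_spectral_diag_real AC_herm.
have /hermitian_normalmx/orthomx_spectralP AC_eq := AC_herm.
set P := spectralmx AC in AC_eq; set dC := spectral_diag AC in d_real AC_eq.
have P_unit : P \in unitmx := spectral_unit AC.
have D_real : diag_mx dC \is a mxOver Num.real.
  by apply/mxOverP => i j; rewrite mxE rpredMn // (mxOverP d_real).
have [|Q] := @real_similar _ n AC (diag_mx dC) _ AC_real D_real.
  exists P => //; apply/similarP => //.
  by rewrite {1}AC_eq !mulmxA mulmxV // mul1mx.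
rewrite inE => /andP[Q_real Q_unit] /(similarP Q_unit) eqQ.
pose reM m p (M : 'M[R[i]]_(m, p)) := map_mx (@complex.Re R) M.
have reK m p (M : 'M[R[i]]_(m, p)) : M \is a mxOver Num.real ->
    map_mx toC (reM _ _ M) = M.
  move=> M_real; apply/matrixP=> i j; rewrite !mxE.
  by apply: RRe_real; apply: (mxOverP M_real).
exists (reM _ _ dC), (reM _ _ Q); split.
  by rewrite -(map_unitmx toC) reK.
by apply: (map_mx_inj (f := toC)); rewrite !map_mxM map_diag_mx !reK.
Qed.

(** By symmetry the rows of S are eigenvectors of A; distinct eigenvalues make them orthogonal, so
    only normalization remains. *)
Lemma orthonormal_eigenbasis_of_simple (K : realType) n (A S : 'M[K]_n)
    (d : 'rV[K]_n) :
  A^T = A -> S \in unitmx -> S *m A = diag_mx d *m S -> injective (d 0) ->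
  exists lam phi, orthonormal_eigenbasis A lam phi.
Proof.
move=> A_sym S_unit SA d_inj.
have rowSA k : row k S *m A = d 0 k *: row k S.
  by rewrite -row_mul SA row_mul row_diag_mx -scalemxAl -rowE.
have eigS k : A *m (row k S)^T = d 0 k *: (row k S)^T.
  by rewrite -{1}A_sym -trmx_mul rowSA linearZ.
pose dot k l := \sum_j S k j * S l j.
have dotE k l : row k S *m (row l S)^T = (dot k l)%:M.
  apply/matrixP => i j; rewrite !ord1 !mxE eqxx.
  by apply: eq_bigr => m _; rewrite !mxE.
have ortho k l : k != l -> dot k l = 0.
  move=> kl; have : (d 0 k - d 0 l) * dot k l = 0.
    apply/eqP; rewrite mulrBl subr_eq0.
    have : row k S *m A *m (row l S)^T = row k S *m (A *m (row l S)^T).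
      by rewrite mulmxA.
    rewrite rowSA eigS -scalemxAl -scalemxAr dotE => /matrixP/(_ 0 0).
    by rewrite !mxE eqxx => ->.
  move=> /eqP; rewrite mulf_eq0 subr_eq0 => /orP[/eqP/d_inj/eqP|/eqP //].
  by rewrite (negPf kl).
have dot_gt0 k : 0 < dot k k.
  have ge0 : 0 <= dot k k by apply: sumr_ge0 => j _; rewrite -expr2 sqr_ge0.
  rewrite lt_neqAle ge0 andbT eq_sym; apply/negP => /eqP/psumr_eq0P sq0.
  have row0 : row k S = 0.
    apply/rowP => j; rewrite !mxE; apply/eqP; rewrite -(@sqrf_eq0 K) expr2.
    by rewrite sq0 // => i _; rewrite -expr2 sqr_ge0.
  have : delta_mx 0 k *m S *m invmx S = 0 :> 'rV_n by rewrite -rowE row0 mul0mx.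
  by rewrite mulmxK // => /rowP/(_ k)/eqP; rewrite !mxE !eqxx oner_eq0.
exists (d 0), (fun k => (Num.sqrt (dot k k))^-1 *: (row k S)^T); split=> k.
  move=> l; transitivity
    ((Num.sqrt (dot k k))^-1 * (Num.sqrt (dot l l))^-1 * dot k l).
    by rewrite mulr_sumr; apply: eq_bigr => j _; rewrite !mxE mulrACA.
  have [<-|kl] := eqVneq k l; last by rewrite (ortho _ _ kl) mulr0.
  rewrite -invfM -expr2 sqr_sqrtr ?ltW // mulVf //.
  by rewrite gt_eqF.
by rewrite -scalemxAr eigS !scalerA mulrC.
Qed.

(** * Simplicity of the spectrum and Conditions B_2 and (I) *)

Section Spectrum.
Variables (R : realFieldType) (n : nat) (rho : R).
Hypothesis rho_large : 2 * n%:R * (8 * n%:R) ^+ n <= rho.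

Lemma eigvec_proportional (E : rel 'I_n) lam (x y : 'I_n -> R) c :
  eigvec rho E lam x -> eigvec rho E lam y -> peak x c ->
  forall i, x c * y i = y c * x i.
Proof.
move=> eig_x eig_y peak_x i; pose z j := x c * y j - y c * x j.
have eig_z : eigvec rho E lam z.
  move=> j; rewrite /z mulrBr mulrCA eig_y [X in _ - X]mulrCA eig_x.
  by rewrite sumrB !mulr_sumr.
(* z vanishes at c, but if z is nonzero then c is its only possible peak. *)
apply/eqP; rewrite -subr_eq0; apply: contraT => zi0.
have [c' peak_z] := peak_exists (x := z) zi0.
have [cc'|c'c] := eqVneq c' c.
  by have := peak_z.1; rewrite cc' /z mulrC subrr eqxx.
(* A peak c' of z other than c would give q <= 2n, against 16n <= rho <= q. *)
have := peak_gap rho_large eig_x peak_x c'c.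
have := peak_eigenvalue eig_z peak_z; have := rho_le_pow rho_large c c.
have := nonempty_ge1 R c; have [] := rho_large_lin rho_large c.
lra.
Qed.

(** The tolerance 4n allows an error n for each of four eigenvalues and is at most rho/4. With both
    pairs sorted, unequal larger indices already separate the sums by lacunarity; equal ones cancel
    and the smaller indices are compared. *)
Lemma pow_sum_separated (a b a' b' : 'I_n) :
  `|rho ^+ a.+1 + rho ^+ b.+1 - (rho ^+ a'.+1 + rho ^+ b'.+1)| <= 4 * n%:R ->
  [set a; b] = [set a'; b'].
Proof.
have n1 := nonempty_ge1 R a; have [r16 rn] := rho_large_lin rho_large a.
wlog ba : a b / (b <= a)%N => [IH|].
  have [|/ltnW] := leqP b a; first exact: IH.
  by move=> ab; rewrite (addrC (rho ^+ a.+1)) setUC; apply: IH.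
wlog ba' : a' b' / (b' <= a')%N => [IH|].
  have [|/ltnW] := leqP b' a'; first exact: IH.
  by move=> ab'; rewrite (addrC (rho ^+ a'.+1)) [RHS]setUC; apply: IH.
wlog aa' : a b a' b' ba ba' n1 / (a' <= a)%N => [IH|].
  have [|/ltnW] := leqP a' a; first exact: IH.
  by move=> ab' h; apply/esym; apply: IH; rewrite // distrC.
have pow_ge i : rho <= rho ^+ (i : 'I_n).+1 := rho_le_pow rho_large a i.
have pow_lt (i j : 'I_n) : (i < j)%N -> 16 * rho ^+ i.+1 <= rho ^+ j.+1.
  move=> /(pow_lacunary rho_large a); apply: le_trans.
  by rewrite ler_wpM2r // (le_trans _ (pow_ge i)) //; lra.
have := pow_ge a; have := pow_ge b; have := pow_ge a'; have := pow_ge b'.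
move=> rb' ra' rb ra; rewrite ler_norml => /andP[h1 h2].
move: aa'; rewrite leq_eqVlt => /orP[/eqP/val_inj aa'|/pow_lt lt_aa'].
  rewrite aa' in h1 h2 *.
  have [/pow_lt lt_b|/pow_lt lt_b|/val_inj ->//] := ltngtP b b'.
    by exfalso; lra.
  by exfalso; lra.
have : rho ^+ b'.+1 <= rho ^+ a'.+1 by rewrite ler_weXn2l //; lra.
by move=> ?; exfalso; lra.
Qed.

Variables (E : rel 'I_n) (lam : 'I_n -> R) (phi : 'I_n -> 'I_n -> R).
Hypothesis phi_orth : forall k l, \sum_j phi k j * phi l j = (k == l)%:R.
Hypothesis phi_eig : forall k, eigvec rho E (lam k) (phi k).

(** A one-sided inverse of a square matrix is two-sided, so orthonormality passes to the
    transpose. *)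
Lemma orthonormal_rows j : \sum_k phi k j ^+ 2 = 1.
Proof.
pose F : 'M[R]_n := \matrix_(k, i) phi k i.
have /mulmx1C/matrixP/(_ j j) : F *m F^T = 1%:M.
  apply/matrixP => k l; rewrite !mxE -phi_orth.
  by apply: eq_bigr => i _; rewrite !mxE.
rewrite !mxE eqxx => F_eq; rewrite -[RHS]F_eq.
by apply: eq_bigr => k _; rewrite !mxE expr2.
Qed.

Lemma phi_peaks : exists2 c : 'I_n -> 'I_n, bijective c &
  forall k, peak (phi k) (c k) /\ 1 < 2 * phi k (c k) ^+ 2.
Proof.
have norm1 k : \sum_j phi k j ^+ 2 = 1 by have := phi_orth k k; rewrite eqxx.
have /fin_all_exists[c peak_c] k : exists c, peak (phi k) c.
  have [i xi0|phi0] := pickP (fun i => phi k i != 0).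
    exact: peak_exists xi0.
  have := norm1 k; rewrite big1 => [/esym/eqP|i _]; first by rewrite oner_eq0.
  by move/negbFE/eqP: (phi0 i) => ->; rewrite expr0n.
have big_c k : 1 < 2 * phi k (c k) ^+ 2.
  by have := peak_sqr rho_large (phi_eig k) (peak_c k); rewrite norm1.
exists c; last by split.
(* Two eigenvectors sharing a peak would give squares summing to more than 1 at that coordinate. *)
apply: injF_bij => k l ckl; apply/eqP; apply: contraT => kl.
have := orthonormal_rows (c k); rewrite (bigD1 k) //= (bigD1 l) 1?eq_sym //=.
have := big_c k; have := big_c l; rewrite -ckl.
have : 0 <= \sum_(i | (i != k) && (i != l)) phi i (c k) ^+ 2.
  by apply: sumr_ge0 => i _; rewrite sqr_ge0.
lra.
Qed.

Lemma eigenvalue_B2 j k j' k' :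
  lam j + lam k = lam j' + lam k' <-> [set j; k] = [set j'; k'].
Proof.
have [c /bij_inj c_inj peak_c] := phi_peaks; split=> [lam_eq|set_eq].
  suff : [set c j; c k] = [set c j'; c k'].
    by rewrite -!imset_set1 -!imsetU => /(imset_inj c_inj).
  have eig i := peak_eigenvalue (phi_eig i) (peak_c i).1.
  apply: pow_sum_separated.
  have := eig j; have := eig k; have := eig j'; have := eig k'.
  by rewrite !ler_norml; lra.
(* This writes the sum as a function of the set alone; a singleton counts its eigenvalue twice. *)
have lamE (i l : 'I_n) : lam i + lam l =
    if #|[set i; l]| == 1%N then \sum_(m in [set i; l]) lam m *+ 2
    else \sum_(m in [set i; l]) lam m.
  rewrite cards2; have [->|il] := eqVneq i l.
    by rewrite setUid big_set1 mulr2n.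
  by rewrite /= big_setU1 ?inE //= big_set1.
by rewrite !lamE set_eq.
Qed.

(** For u in the left kernel with |u_j| maximal, take the column of the eigenvector peaked at j: it
    sums to 1 and its j-th entry exceeds 1/2, so u_j cannot be balanced by the rest. *)
Lemma phi_sqr_unit : \matrix_(j, k) phi k j ^+ 2 \in unitmx.
Proof.
have [c [g cK gK] peak_c] := phi_peaks.
rewrite -row_free_unit; apply: inj_row_free => u uM0.
apply/rowP => i; rewrite mxE; apply/eqP; apply: contraT => ui0.
have [j [uj0 max_j]] := peak_exists (x := u 0) ui0.
have := peak_c (g j); rewrite gK => -[_]; set k := g j => big_kj.
have /rowP/(_ k) := uM0; rewrite !mxE (bigD1 j) //= mxE => /eqP.
rewrite addr_eq0 => /eqP/(congr1 (fun a => `|a|)).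
rewrite normrN normrM => eq_j.
have norm1 : \sum_i phi k i ^+ 2 = 1 by have := phi_orth k k; rewrite eqxx.
have : `|u 0 j| * `|phi k j ^+ 2| <= `|u 0 j| * (1 - phi k j ^+ 2).
  rewrite eq_j -norm1 [in leRHS](bigD1 j) //= [_ + _ - _]addrC addKr mulr_sumr.
  apply: le_trans (ler_norm_sum _ _ _) (ler_sum _ _) => l _.
  by rewrite mxE normrM (ger0_norm (sqr_ge0 (phi k l))) ler_wpM2r ?sqr_ge0.
rewrite ler_pM2l ?normr_gt0 // ger0_norm ?sqr_ge0 //.
lra.
Qed.

End Spectrum.

(** * The Hamiltonian of a graph and Condition (S) *)

Lemma hamiltonian_tr (R : realType) (V : finType) (e : rel V) n
    (v : 'I_n -> V) (rho : R) : symmetric e ->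
  (hamiltonian e v rho)^T = hamiltonian e v rho.
Proof.
move=> e_sym; rewrite hamiltonianE raddfB /= tr_diag_mx; congr (_ - _).
by apply/matrixP => i j; rewrite !mxE e_sym.
Qed.

Lemma hamiltonian_eigvec (R : realType) (V : finType) (e : rel V) n
    (v : 'I_n -> V) (rho lam : R) (x : 'cV[R]_n) :
  hamiltonian e v rho *m x = lam *: x ->
  eigvec rho (fun i j => e (v i) (v j)) lam (fun i => x i 0).
Proof.
rewrite hamiltonianE mulmxBl => Hx i.
have /colP/(_ i) := Hx; rewrite mul_diag_mx !mxE => /eqP.
rewrite subr_eq addrC -subr_eq -mulrBl => /eqP ->.
rewrite [RHS]big_mkcond; apply: eq_bigr => j _; rewrite mxE.
by case: (e _ _); rewrite ?mul1r ?mul0r.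
Qed.

(** Two rows of S with a common eigenvalue would be proportional by [eigvec_proportional],
    contradicting the invertibility of S. *)
Lemma hamiltonian_orthonormal_eigenbasis (R : realType) (V : finType)
    (e : rel V) n (v : 'I_n -> V) (rho : R) :
  symmetric e -> 2 * n%:R * (8 * n%:R) ^+ n <= rho ->
  exists lam phi, orthonormal_eigenbasis (hamiltonian e v rho) lam phi.
Proof.
move=> e_sym rho_large; have H_tr := hamiltonian_tr v rho e_sym.
have [d [S [S_unit SH]]] := sym_diagonalizable H_tr.
apply: (orthonormal_eigenbasis_of_simple H_tr S_unit SH) => k l dkl.
apply/eqP; apply: contraT => kl.
have eigS m : eigvec rho (fun i j => e (v i) (v j)) (d 0 m) (fun i => S m i).
  move=> i; have := @hamiltonian_eigvec _ _ e n v rho (d 0 m) (row m S)^T.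
  rewrite -{1}H_tr -trmx_mul -row_mul SH row_mul row_diag_mx -scalemxAl -rowE.
  rewrite linearZ => /(_ erefl) /(_ i); rewrite !mxE => ->.
  by apply: eq_bigr => j _; rewrite !mxE.
have S_inj (u : 'rV_n) : u *m S = 0 -> u = 0.
  by move=> uS; rewrite -[u](mulmxK S_unit) uS mul0mx.
have [c peak_c] : exists c, peak (S k) c.
  have [i ski0|Sk0] := pickP (fun i => S k i != 0).
    exact: peak_exists ski0.
  have /S_inj/rowP/(_ k)/eqP : delta_mx 0 k *m S = 0 :> 'rV_n.
    by rewrite -rowE; apply/rowP => i; rewrite !mxE; apply/eqP/negbFE/Sk0.
  by rewrite !mxE !eqxx oner_eq0.
have eig_l := eigS l; rewrite -dkl in eig_l.
have prop := eigvec_proportional rho_large (eigS k) eig_l peak_c.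
have /S_inj/rowP/(_ l)/eqP :
    (S k c *: delta_mx 0 l - S l c *: delta_mx 0 k) *m S = 0 :> 'rV_n.
  rewrite mulmxBl -!scalemxAl -!rowE; apply/rowP => i.
  by rewrite !mxE prop subrr.
rewrite !mxE !eqxx /= [l == k]eq_sym (negPf kl) mulr1 mulr0 subr0.
by rewrite (negPf peak_c.1).
Qed.

Lemma eigvec_root_nonvanishing (R : realType) (V : finType) (e : rel V) n
    (a : V) (v : 'I_n -> V) (rho lam : R) (x : 'I_n -> R) (i0 : 'I_n) :
  symmetric e -> connected_graph e -> #|V| = n -> bijective v ->
  (forall i j : 'I_n, (i < j)%N -> (gdist e a (v i) <= gdist e a (v j))%N) ->
  2 * n%:R * (8 * n%:R) ^+ n <= rho ->
  eigvec rho (fun i j => e (v i) (v j)) lam x ->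
  (exists c, peak x c) -> v i0 = a -> x i0 != 0.
Proof.
move=> e_sym e_conn cardV v_bij v_mono rho_large eig_x [c peak_x] vi0.
have [g gK vK] := v_bij.
apply: (peak_nonvanishing rho_large eig_x peak_x
  (d := fun i => gdist e (v c) (v i)) (h := fun i => gdist e a (v i))).
- exact: gdistxx.
- by move=> i /(gdist_eq0 e_conn)/(bij_inj v_bij).
- by move=> i j; rewrite e_sym => /(gdist_edge e_conn).
- by move=> i; rewrite -[leqRHS]cardV gdist_leq_card.
- move=> i /(gdist_pred e_conn)[y]; rewrite e_sym -[y]vK => eiy dist_y.
  by exists (g y).
- by move=> i j /(gdist_edge e_conn).
- move=> i; apply: contraTT; rewrite -!leqNgt leq_eqVlt.
  by move=> /orP[/eqP/val_inj->//|]; exact: v_mono.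
- by move=> i; rewrite [X in (_ + X)%N](gdist_sym e_sym) // gdist_triangle.
(* The root ends every geodesic from v_c to it: h is 0 there and d equals h c. *)
by rewrite vi0 gdistxx (gdist_sym e_sym).
Qed.

Theorem proposition3p1 (R : realType) (V : finType) (e : rel V) (n : nat) :
  simple_graph e -> connected_graph e -> #|V| = n ->
  exists R0 : R, 0 < R0 /\
    forall (a : V) (v : 'I_n -> V),
      bijective v ->
      (forall i : 'I_n, i = 0%N :> nat -> v i = a) ->
      (forall i j : 'I_n, (i < j)%N ->
         (gdist e a (v i) <= gdist e a (v j))%N) ->
      forall rho : R, 1 < rho -> R0 < rho ->
        satisfies_B2_I_S (hamiltonian e v rho).
Proof.
(* The summand 1 keeps the constant positive for n = 0. *)
move=> [e_sym _] e_conn cardV; exists (2 * n%:R * (8 * n%:R) ^+ n + 1); split.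
  by rewrite ltr_wpDl ?mulr_ge0 ?exprn_ge0 ?mulr_ge0 ?ler0n.
move=> a v v_bij _ v_mono rho _ /ltW rho_ge.
have {rho_ge} rho_large : 2 * n%:R * (8 * n%:R) ^+ n <= rho by lra.
split=> [|lam phi [phi_orth phi_eig]].
  exact: hamiltonian_orthonormal_eigenbasis.
have eig k := hamiltonian_eigvec (phi_eig k).
have [c _ peak_c] := phi_peaks rho_large phi_orth eig.
split.
- by move=> i j i' j'; exact: (eigenvalue_B2 rho_large phi_orth eig).
- exact: (phi_sqr_unit rho_large phi_orth eig).
(* The index of the root serves as witness for all pairs at once. *)
move=> k l _; have [g _ vK] := v_bij; exists (g a).
have root_neq0 m : phi m (g a) 0 != 0.
  apply: (eigvec_root_nonvanishing e_sym e_conn cardV v_bij v_mono rho_large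
    (eig m) _ (vK a)).
  by exists (c m); exact: (peak_c m).1.
by rewrite mulf_neq0.
Qed.
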